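(* Let $(Z,\rho_0)$ be an antipodal space. Then the metric space $(\mathcal{M}(Z), d_{\mathcal{M}})$ (the Moebius space of $Z$) is unbounded, contractible, proper, geodesic and geodesically complete.
   Context: Antipodal spaces and Moebius spaces. Let $Z$ be a compact metrizable space containing at least four points. A separating function on $Z$ is a continuous function $\rho : Z\times Z\to[0,\infty)$ which is symmetric and satisfies $\rho(\xi,\eta)=0$ if and only if $\xi=\eta$. Its cross-ratio is defined on quadruples of distinct points of $Z$ by $[\xi,\xi',\eta,\eta']_\rho=\frac{\rho(\xi,\eta)\rho(\xi',\eta')}{\rho(\xi,\eta')\rho(\xi',\eta)}$. Two separating functions are Moebius equivalent if their cross-ratios agree. If $\rho_1,\rho_2$ are Moebius equivalent, there is a unique positive continuous function $\frac{d\rho_2}{d\rho_1}:Z\to(0,\infty)$, the derivative of $\rho_2$ with respect to $\rho_1$, such that $\rho_2(\xi,\eta)^2=\frac{d\rho_2}{d\rho_1}(\xi)\frac{d\rho_2}{d\rho_1}(\eta)\rho_1(\xi,\eta)^2$ for all $\xi,\eta\in Z$; explicitly $\frac{d\rho_2}{d\rho_1}(\xi)=\frac{\rho_2(\xi,\eta)\rho_2(\xi,\eta')\rho_1(\eta,\eta')}{\rho_1(\xi,\eta)\rho_1(\xi,\eta')\rho_2(\eta,\eta')}$ for any two distinct points $\eta,\eta'$ different from $\xi$. An antipodal function on $Z$ is a separating function $\rho$ such that $\sup_{\xi,\eta}\rho(\xi,\eta)=1$ and for every $\xi\in Z$ there is $\eta\in Z$ with $\rho(\xi,\eta)=1$.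 An antipodal space $(Z,\rho_0)$ is such a space $Z$ equipped with an antipodal function $\rho_0$. Its Moebius space $\mathcal{M}(Z)=\mathcal{M}(Z,\rho_0)$ is the set of all antipodal functions on $Z$ Moebius equivalent to $\rho_0$, with the metric $d_{\mathcal{M}}(\rho_1,\rho_2)=\left\|\log\frac{d\rho_2}{d\rho_1}\right\|_\infty$ (sup norm over $Z$). A metric space is proper if all closed bounded balls are compact, geodesic if any two points are joined by a geodesic segment (isometric image of a compact interval), and geodesically complete if every geodesic segment extends to a bi-infinite geodesic (a distance-preserving map from $\mathbb{R}$). *)

(* Defs.v *)
From HB Require Import structures.
From mathcomp Require Import all_boot all_order all_algebra.
From mathcomp Require Import ring.
From mathcomp Require Import all_classical all_reals all_analysis.

Set Implicit Arguments.
Unset Strict Implicit.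
Unset Printing Implicit Defensive.

Import Order.TTheory GRing.Theory Num.Theory.
Import numFieldNormedType.Exports.

Local Open Scope classical_set_scope.
Local Open Scope ring_scope.

Definition metrizable (R : realType) (T : topologicalType) : Prop :=
  exists d : T -> T -> R,
    [/\ forall x y, d x y = 0 <-> x = y,
        forall x y, d x y = d y x,
        forall x y z, d x z <= d x y + d y z &
        forall x (A : set T), nbhs x A <->
          exists2 e : R, 0 < e & [set y | d x y < e] `<=` A].

Section separating_functions.
Variables (R : realType) (T : topologicalType).
Implicit Types rho : T -> T -> R.

Definition separating rho : Prop :=
  [/\ continuous (fun p : T * T => rho p.1 p.2),
      forall x y, 0 <= rho x y,
      forall x y, rho x y = rho y x &
      forall x y, rho x y = 0 <-> x = y].

Definition cross_ratio rho (x x' y y' : T) : R :=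
  (rho x y * rho x' y') / (rho x y' * rho x' y).

Definition moebius_equiv rho1 rho2 : Prop :=
  forall x x' y y', uniq [:: x; x'; y; y'] ->
    cross_ratio rho1 x x' y y' = cross_ratio rho2 x x' y y'.

(* The library's [sup] is 0 on sets without a supremum, so the second clause
   also says that [rho] is bounded. *)
Definition antipodal rho : Prop :=
  [/\ separating rho,
      sup (range (fun p : T * T => rho p.1 p.2)) = 1 &
      forall x, exists y, rho x y = 1].

Definition is_mderiv rho1 rho2 (f : T -> R) : Prop :=
  [/\ forall x, 0 < f x, continuous f &
      forall x y, rho2 x y ^+ 2 = f x * f y * rho1 x y ^+ 2].

(* d rho2 / d rho1, well defined for Moebius equivalent separating functions
   on a space with at least four points: see [mderivP], [is_mderiv_uniq] and
   the explicit formula [mderivE]. *)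
Definition mderiv rho1 rho2 : T -> R := xget (cst 1) (is_mderiv rho1 rho2).

Definition sup_norm (f : T -> R) : R := sup (range (fun x => `|f x|)).

End separating_functions.

(* Being metrizable refers to R-valued metrics, R being the ambient model of
   the real numbers. *)
Structure antipodalSpace (R : realType) := AntipodalSpace {
  antipodal_carrier :> topologicalType;
  antipodal_compact : compact [set: antipodal_carrier];
  antipodal_metrizable : metrizable R antipodal_carrier;
  antipodal_four_points :
    exists x1 x2 x3 x4 : antipodal_carrier, uniq [:: x1; x2; x3; x4];
  antipodal_fun : antipodal_carrier -> antipodal_carrier -> R;
  antipodal_funP : antipodal antipodal_fun }.

Record moebiusSpace (R : realType) (Z : antipodalSpace R) := MoebiusSpace {
  moebius_fun :> Z -> Z -> R;
  moebius_antipodal : antipodal moebius_fun;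
  moebius_equivP : moebius_equiv moebius_fun (@antipodal_fun R Z) }.

Section derivative.
Variables (R : realType) (T : topologicalType).
Implicit Types (rho : T -> T -> R) (f : T -> R).
Hypothesis T4 : exists x1 x2 x3 x4 : T, uniq [:: x1; x2; x3; x4].

Lemma other_point (x y z : T) : exists t, [/\ t != x, t != y & t != z].
Proof.
have [x1 [x2 [x3 [x4 u]]]] := T4.
have [t] : exists2 t, t \in [:: x1; x2; x3; x4] & t \notin [:: x; y; z].
  apply/hasP; apply: contraT => /hasPn h.
  have := @uniq_leq_size _ _ [:: x; y; z] u.
  by rewrite ltnn => F; apply: F => t /h; rewrite negbK.
by rewrite !inE !negb_or => _ /and3P[]; exists t.
Qed.

Lemma sep_gt0 rho x y : separating rho -> x != y -> 0 < rho x y.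
Proof.
move=> [_ r0 _ re] xy; rewrite lt_neqAle r0 andbT eq_sym.
by apply: contra xy => /eqP/re/eqP.
Qed.

Lemma is_mderiv_formula rho1 rho2 f x y y' :
  separating rho1 -> separating rho2 -> is_mderiv rho1 rho2 f ->
  x != y -> x != y' -> y != y' ->
  f x = (rho2 x y * rho2 x y' * rho1 y y') /
        (rho1 x y * rho1 x y' * rho2 y y').
Proof.
move=> s1 s2 [f0 _ fE] xy xy' yy'.
have [a1 a2 a3] : [/\ 0 < rho1 x y, 0 < rho1 x y' & 0 < rho1 y y'].
  by split; exact: sep_gt0.
have [b1 b2 b3] : [/\ 0 < rho2 x y, 0 < rho2 x y' & 0 < rho2 y y'].
  by split; exact: sep_gt0.
apply/eqP; rewrite -(@eqrXn2 _ 2)//; last 2 first.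
- exact: ltW.
- by rewrite ltW// divr_gt0// !mulr_gt0.
rewrite !expr_div_n !exprMn !fE; apply/eqP.
have := f0 x; have := f0 y; have := f0 y' => p1 p2 p3.
by field; rewrite !lt0r_neq0.
Qed.

Lemma is_mderiv_uniq rho1 rho2 f g :
  separating rho1 -> separating rho2 ->
  is_mderiv rho1 rho2 f -> is_mderiv rho1 rho2 g -> f = g.
Proof.
move=> s1 s2 fP gP; apply/funext => x.
have [y [yx _ _]] := other_point x x x.
have [z [zx zy _]] := other_point x y x.
rewrite (is_mderiv_formula (x := x) (y := y) (y' := z) s1 s2 fP) 1?eq_sym//.
by rewrite (is_mderiv_formula (x := x) (y := y) (y' := z) s1 s2 gP) 1?eq_sym.
Qed.

Section existence.
Variables rho1 rho2 : T -> T -> R.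
Hypotheses (s1 : separating rho1) (s2 : separating rho2).
Hypothesis e12 : moebius_equiv rho1 rho2.

Let g x y y' := (rho2 x y * rho2 x y' * rho1 y y') /
                (rho1 x y * rho1 x y' * rho2 y y').

Let sym1 x y : rho1 x y = rho1 y x. Proof. by case: s1. Qed.
Let sym2 x y : rho2 x y = rho2 y x. Proof. by case: s2. Qed.

Let gC x y y' : g x y y' = g x y' y.
Proof.
by rewrite /g (sym1 y) (sym2 y) (mulrC (rho2 x y)) (mulrC (rho1 x y)).
Qed.

Let g_step x y y' z : x != y -> x != y' -> x != z -> y != y' -> y != z ->
  g x y y' = g x y z.
Proof.
move=> xy xy' xz yy' yz; have [->//|y'z] := eqVneq y' z.
have := @e12 x y y' z; rewrite /= !inE !negb_or xy xy' xz yy' yz y'z => /(_ isT).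
rewrite /cross_ratio /g => E.
have P1 u v : u != v -> rho1 u v != 0 by move=> ?; rewrite lt0r_neq0// sep_gt0.
have P2 u v : u != v -> rho2 u v != 0 by move=> ?; rewrite lt0r_neq0// sep_gt0.
have [] := (P1 _ _ xy, P1 _ _ xy') => a1 a2.
have [] := (P1 _ _ xz, P1 _ _ yy') => a3 a4.
have [] := (P2 _ _ xy, P2 _ _ xy') => b1 b2.
have [] := (P2 _ _ xz, P2 _ _ yy') => b3 b4.
have [] := (P1 _ _ yz, P2 _ _ yz) => a5 b5.
have := E; move/eqP; rewrite eqr_div ?mulf_neq0// => /eqP {}E.
apply/eqP; rewrite eqr_div ?mulf_neq0//; apply/eqP.
transitivity (rho2 x y * rho1 x y *
   (rho2 x y' * rho2 y z * (rho1 x z * rho1 y y'))); first by ring.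
by rewrite -E; ring.
Qed.

Let g_indep x y y' z z' : x != y -> x != y' -> y != y' ->
  x != z -> x != z' -> z != z' -> g x y y' = g x z z'.
Proof.
move=> xy xy' yy' xz xz' zz'.
have [yz|yz] := eqVneq y z; first by subst z; exact: g_step.
by rewrite (@g_step x y y' z)// gC; apply: g_step; rewrite // eq_sym.
Qed.

Lemma is_mderiv_exists : exists f, is_mderiv rho1 rho2 f.
Proof.
have /choice[h hP] : forall x, exists p : T * T,
    [/\ x != p.1, x != p.2 & p.1 != p.2].
  move=> x; have [y [yx _ _]] := other_point x x x.
  by have [z [zx zy _]] := other_point x y x; exists (y, z); split; rewrite eq_sym.
have gE x y y' : x != y -> x != y' -> y != y' -> g x (h x).1 (h x).2 = g x y y'.
  by move=> *; have [? ? ?] := hP x; exact: g_indep.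
have sc rho a : separating rho -> continuous (fun x => rho x a).
  move=> [rc _ _ _] x.
  apply: (@continuous_comp _ _ _ (fun x => (x, a)) (fun p => rho p.1 p.2)).
    by apply: cvg_pair; [exact: cvg_id|exact: cvg_cst].
  exact: rc.
exists (fun x => g x (h x).1 (h x).2); split.
- by move=> x; have [? ? ?] := hP x; rewrite divr_gt0// !mulr_gt0// sep_gt0.
- move=> x; have := hP x; case: (h x) => y y' /= [xy xy' yy'].
  have nz1 : rho1 x y != 0 by rewrite lt0r_neq0// sep_gt0.
  have nz2 : rho1 x y' != 0 by rewrite lt0r_neq0// sep_gt0.
  have nz3 : rho2 y y' != 0 by rewrite lt0r_neq0// sep_gt0.
  have near_neq (a : T) : rho1 x a != 0 -> \forall t \near x, t != a.
    move=> xa; have : \forall t \near x, rho1 t a != 0.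
      exact: (cvgr_neq0 _ (sc rho1 a s1 x)).
    apply: filterS => t; apply: contra => /eqP ->.
    by apply/eqP; case: s1 => _ _ _ ->.
  have nE : \forall t \near x, g t y y' = g t (h t).1 (h t).2.
    near=> t; apply/esym/gE => //.
    - by near: t; exact: near_neq.
    - by near: t; exact: near_neq.
  rewrite /continuous_at (gE x y y')//.
  apply: cvg_trans (near_eq_cvg nE) _.
  apply: cvgM; first by apply: cvgMl; apply: cvgM; exact: sc.
  apply: cvgV; first by rewrite !mulf_neq0.
  by apply: cvgMl; apply: cvgM; exact: sc.
- move=> x y; have [->|xy] := eqVneq x y.
    have -> : rho1 y y = 0 by case: s1 => _ _ _ ->.
    have -> : rho2 y y = 0 by case: s2 => _ _ _ ->.
    by rewrite expr0n /= mulr0.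
  have [z [zx zy _]] := other_point x y x.
  have xz : x != z by rewrite eq_sym.
  have yz : y != z by rewrite eq_sym.
  have yx : y != x by rewrite eq_sym.
  rewrite /= (gE x y z)// (gE y x z)// /g (sym1 y x) (sym2 y x).
  have P1 u v : u != v -> rho1 u v != 0 by move=> ?; rewrite lt0r_neq0// sep_gt0.
  have P2 u v : u != v -> rho2 u v != 0 by move=> ?; rewrite lt0r_neq0// sep_gt0.
  by field; rewrite !P1 ?P2.
Unshelve. all: by end_near. Qed.

Lemma mderivP : is_mderiv rho1 rho2 (mderiv rho1 rho2).
Proof. by have [f fP] := is_mderiv_exists; exact: (xgetI _ fP). Qed.

Lemma mderivE x y y' : x != y -> x != y' -> y != y' ->
  mderiv rho1 rho2 x = (rho2 x y * rho2 x y' * rho1 y y') /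
                       (rho1 x y * rho1 x y' * rho2 y y').
Proof. exact: is_mderiv_formula mderivP. Qed.

End existence.

Lemma mderiv_eq rho1 rho2 f : separating rho1 -> separating rho2 ->
  is_mderiv rho1 rho2 f -> mderiv rho1 rho2 = f.
Proof.
move=> s1 s2 fP; apply: (is_mderiv_uniq s1 s2 _ fP).
exact: (xgetI _ fP).
Qed.

End derivative.

Section moebius_metric.
Variables (R : realType) (Z : antipodalSpace R).
Implicit Types r : moebiusSpace Z.

HB.instance Definition _ := gen_eqMixin (moebiusSpace Z).
HB.instance Definition _ := gen_choiceMixin (moebiusSpace Z).

Definition moebius_dist r1 r2 : R :=
  sup_norm (fun x => ln (mderiv r1 r2 x)).

Lemma moebius_sep r : separating r.
Proof. by have [] := moebius_antipodal r. Qed.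

Lemma moebius_equiv12 r1 r2 : moebius_equiv r1 r2.
Proof. by move=> *; rewrite !moebius_equivP. Qed.

Lemma moebius_derivP r1 r2 : is_mderiv r1 r2 (mderiv r1 r2).
Proof.
apply: mderivP; [exact: antipodal_four_points|exact: moebius_sep..|].
exact: moebius_equiv12.
Qed.

Lemma moebius_deriv_eq r1 r2 f : is_mderiv r1 r2 f -> mderiv r1 r2 = f.
Proof.
apply: mderiv_eq; [exact: antipodal_four_points|exact: moebius_sep..].
Qed.

Lemma moebius_dist_has_sup r1 r2 :
  has_sup (range (fun x => `|ln (mderiv r1 r2 x)|)).
Proof.
have [x [_ _]] := antipodal_four_points Z.
split; first by exists (`|ln (mderiv r1 r2 x)|), x.
have [d0 dc _] := moebius_derivP r1 r2.
have fc : continuous (fun x => `|ln (mderiv r1 r2 x)|).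
  move=> z; apply: cvg_norm.
  apply: (@continuous_comp _ _ _ (mderiv r1 r2) (@ln R)); first exact: dc.
  exact: continuous_ln.
have := continuous_compact (continuous_subspaceT fc) (@antipodal_compact R Z).
move/compact_bounded => [M [_ /(_ (M + 1))]]; rewrite ltrDl ltr01 => /(_ isT) h.
by exists (M + 1) => t /h; exact: le_trans (ler_norm t).
Qed.

Lemma moebius_dist_ub r1 r2 x : `|ln (mderiv r1 r2 x)| <= moebius_dist r1 r2.
Proof. by apply: sup_upper_bound; [exact: moebius_dist_has_sup|exists x]. Qed.

Lemma moebius_dist_le r1 r2 M :
  (forall x, `|ln (mderiv r1 r2 x)| <= M) -> moebius_dist r1 r2 <= M.
Proof.
move=> h; apply: ge_sup; first by have [] := moebius_dist_has_sup r1 r2.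
by move=> _ [x _ <-].
Qed.

Let dist_xx r : moebius_dist r r = 0.
Proof.
have E : mderiv r r = cst 1.
  by apply: moebius_deriv_eq; split=> [x|x|x y];
    [exact: ltr01|exact: cvg_cst|rewrite !mul1r].
apply/eqP; rewrite eq_le; apply/andP; split.
  by apply: moebius_dist_le => x; rewrite E ln1 normr0.
have [x _] := antipodal_four_points Z.
by apply: le_trans (moebius_dist_ub r r x).
Qed.

Let dist_positivity r1 r2 : moebius_dist r1 r2 = 0 -> r1 = r2.
Proof.
move=> d0; have [p _ E] := moebius_derivP r1 r2.
have D1 x : mderiv r1 r2 x = 1.
  apply: ln_inj; rewrite ?posrE ?ltr01// ln1; apply/eqP.
  by rewrite -normr_le0 -d0 moebius_dist_ub.
suff : moebius_fun r1 = r2.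
  case: r1 r2 {d0 p E D1} => [f1 a1 e1] [f2 a2 e2] /= f12; subst f2.
  by congr MoebiusSpace; exact: Prop_irrelevance.
have [_ r10 _ _] := moebius_sep r1; have [_ r20 _ _] := moebius_sep r2.
apply/funext => x; apply/funext => y; apply/eqP.
by rewrite -(@eqrXn2 _ 2)// E !D1 !mul1r.
Qed.

Let dist_le_sym r1 r2 : moebius_dist r1 r2 <= moebius_dist r2 r1.
Proof.
have [p c E] := moebius_derivP r2 r1.
have -> : moebius_dist r1 r2 = sup_norm (fun x => ln (mderiv r2 r1 x)^-1).
  rewrite /moebius_dist (@moebius_deriv_eq r1 r2 (fun x => (mderiv r2 r1 x)^-1))//.
  split=> [x|x|x y]; first by rewrite invr_gt0.
    by apply: cvgV; [rewrite lt0r_neq0|exact: c].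
  rewrite E; have := p x; have := p y => p1 p2.
  by field; rewrite !lt0r_neq0.
rewrite /moebius_dist /sup_norm.
suff -> : (fun x => `|ln (mderiv r2 r1 x)^-1|) = (fun x => `|ln (mderiv r2 r1 x)|).
  by [].
by apply/funext => x; rewrite lnV ?posrE// normrN.
Qed.

Let dist_sym r1 r2 : moebius_dist r1 r2 = moebius_dist r2 r1.
Proof. by apply/eqP; rewrite eq_le !dist_le_sym. Qed.

Let dist_triangle r2 r1 r3 :
  moebius_dist r1 r3 <= moebius_dist r1 r2 + moebius_dist r2 r3.
Proof.
have [p12 c12 E12] := moebius_derivP r1 r2.
have [p23 c23 E23] := moebius_derivP r2 r3.
have E : mderiv r1 r3 = (fun x => mderiv r1 r2 x * mderiv r2 r3 x).
  apply: moebius_deriv_eq; split=> [x|x|x y]; first exact: mulr_gt0.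
    by apply: cvgM; [exact: c12|exact: c23].
  by rewrite E23 E12; ring.
apply: moebius_dist_le => x; rewrite E lnM ?posrE//.
by rewrite (le_trans (ler_normD _ _))// lerD// moebius_dist_ub.
Qed.

HB.instance Definition _ := @isMetric.Build R (moebiusSpace Z)
  moebius_dist dist_xx dist_positivity dist_sym dist_triangle.

End moebius_metric.

Lemma mdist_moebiusE (R : realType) (Z : antipodalSpace R)
    (r1 r2 : moebiusSpace Z) :
  mdist r1 r2 = sup_norm (fun x => ln (mderiv r1 r2 x)).
Proof. by []. Qed.

Definition contractible (R : realType) (X : topologicalType) : Prop :=
  exists (x0 : X) (H : X * R -> X),
    [/\ {within [set: X] `*` `[0, 1], continuous H},
        forall x, H (x, 0) = x &
        forall x, H (x, 1) = x0].

Section metric_spaces.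
Variables (R : realType) (X : metricType R).

Definition unbounded_space : Prop :=
  forall M : R, exists x y : X, M < mdist x y.

(* The library's [closed_ball] is the closure of the open ball, which in a
   general metric space can be smaller than the closed ball. *)
Definition proper_space : Prop :=
  forall (x : X) (r : R), compact [set y | mdist x y <= r].

(* A geodesic segment is parametrised by [`[a, b]]; the values of [g] outside
   this interval are irrelevant. *)
Definition is_geodesic_segment (a b : R) (g : R -> X) : Prop :=
  a <= b /\ {in `[a, b] &, forall s t, mdist (g s) (g t) = `|s - t|}.

Definition geodesic_space : Prop :=
  forall x y : X, exists a b g,
    [/\ is_geodesic_segment a b g, g a = x & g b = y].

Definition is_geodesic_line (g : R -> X) : Prop :=
  forall s t, mdist (g s) (g t) = `|s - t|.

Definition geodesically_complete : Prop :=
  forall a b g, is_geodesic_segment a b g ->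
    exists2 l, is_geodesic_line l & {in `[a, b], l =1 g}.

End metric_spaces.

(* Main.v *)
Require Import Defs.
From mathcomp Require Import all_boot all_order all_algebra.
From mathcomp Require Import all_classical all_reals all_analysis.
From mathcomp Require Import ring lra.

Set Implicit Arguments.
Unset Strict Implicit.
Unset Printing Implicit Defensive.

Import Order.TTheory GRing.Theory Num.Theory.
Import numFieldNormedType.Exports.

Local Open Scope classical_set_scope.
Local Open Scope ring_scope.

(** Write b(x, y) = 2 ln rho0(x, y), with the value -oo on the diagonal, and
    attach to an antipodal function r Moebius equivalent to rho0 its potential
    f = - ln (d r / d rho0), so that ln r(x, y)^2 = b(x, y) - f(x) - f(y).
    The function r takes values in [0, 1] and reaches 1 at every point exactly
    when
      f(x) = sup_y (b(x, y) - f(y))   for all x,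
    that is, when f is a fixed point of the conjugation
    f |-> f^c = sup_y (b(., y) - f(y)); such an f is called tight here. The
    metric on the Moebius space becomes the sup distance between potentials,
    so the Moebius space is the tight span (injective hull) construction of
    Isbell and Dress with b in place of a distance, and the whole theorem
    comes from its canonical retraction.

    Call f dominating when f(x) + f(y) >= b(x, y). Then f^c <= f, the average
    (f + f^c) / 2 is dominating again, and the gap f - f^c is at least halved.
    Iterating yields a decreasing, uniformly convergent sequence whose limit is
    tight ([hull_tight]); since conjugation is 1-Lipschitz for the sup
    distance, so is this retraction of the dominating functions onto the tight
    ones ([hull_lip]). No continuity is asked of dominating functions: a
    bounded tight function on a compact space is automatically continuous,
    with a modulus that depends only on its bound
    ([tight_equicontinuous]), so it is the potential of a point of the
    Moebius space ([potential_surj]).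

    - Geodesic, contractible: dominating functions form a convex set, so
      retracting the affine segment between two potentials gives a 1-Lipschitz
      path between them ([segment_lip]), which is a geodesic for reasons of
      length; sliding every potential to that of rho0 is a contraction.
    - Proper: potentials in a ball are uniformly bounded, hence equicontinuous,
      and uniform limits of tight functions are tight.
    - Geodesically complete: lowering f by t at a single point y and raising it
      by t everywhere else keeps it dominating because b(y, y) = -oo. The
      retractions of these tilted functions form a geodesic ray issuing from r
      and pointing towards y ([ray]). Given a segment from r to s, choose y
      where the potential drops by exactly d(r, s) ([mdist_attained]), and y'
      with b(y, y') = f(y) + f(y') for the potential f of r. Along the ray
      from s to y the value at y drops at unit speed; along the ray from r to
      y' the value at y' drops at unit speed, so domination forces the value
      at y to rise at unit speed. Hence the ray towards y', the segment and
      the ray towards y together form a 1-Lipschitz path whose value at y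
      drops at unit speed from end to end, that is, a geodesic line.
    - Unbounded: a point is a degenerate segment, hence lies on a line. *)

(** * Conjugation and dominating functions *)

Section tight_span.
Variables (R : realType) (T : topologicalType) (rho : T -> T -> R).
Hypothesis rhoA : antipodal rho.
Implicit Types (f g : T -> R) (x y : T) (c d e M : R).

Lemma antipodal_sep : separating rho. Proof. by case: rhoA. Qed.

Lemma antipodal_ge0 x y : 0 <= rho x y.
Proof. by case: antipodal_sep. Qed.

Lemma antipodal_sym x y : rho x y = rho y x.
Proof. by case: antipodal_sep. Qed.

Lemma antipodal_diag x : rho x x = 0.
Proof. by case: antipodal_sep => _ _ _ ->. Qed.

Lemma antipodal_partner x : exists y, rho x y = 1.
Proof. by case: rhoA. Qed.

(** The supremum is 1, which is not the default value 0 of [sup]. *)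
Lemma antipodal_has_sup : has_sup (range (fun p : T * T => rho p.1 p.2)).
Proof.
case: rhoA => _ s1 _; apply: contrapT => ns; have /eqP := s1.
by rewrite sup_out// eq_sym oner_eq0.
Qed.

Lemma antipodal_le1 x y : rho x y <= 1.
Proof.
have [_ <- _] := rhoA.
by apply: sup_upper_bound; [exact: antipodal_has_sup|exists (x, y)].
Qed.

(** The inequality b(x, y) <= c for b = 2 ln rho. Exponentiated, it stays
    meaningful on the diagonal, where it always holds, whereas the logarithm of
    0 would not have the intended value -oo. *)
Definition log_le x y c : Prop := rho x y ^+ 2 <= expR c.

Lemma log_leC x y c : log_le x y c -> log_le y x c.
Proof. by rewrite /log_le antipodal_sym. Qed.

Lemma log_le_trans x y c c' : c <= c' -> log_le x y c -> log_le x y c'.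
Proof. by move=> cc' /le_trans; apply; rewrite ler_expR. Qed.

Lemma log_le_diag x c : log_le x x c.
Proof. by rewrite /log_le antipodal_diag expr0n/= expR_ge0. Qed.

Lemma log_le_ge0 x y c : 0 <= c -> log_le x y c.
Proof.
move=> c0; apply: (@le_trans _ _ 1).
  by rewrite exprn_ile1// ?antipodal_ge0// antipodal_le1.
by rewrite -expR0 ler_expR.
Qed.

Lemma log_le_partner x y c : rho x y = 1 -> log_le x y c -> 0 <= c.
Proof. by rewrite /log_le => ->; rewrite expr1n -expR0 ler_expR. Qed.

Lemma log_le_closed x y c :
  (forall e, 0 < e -> log_le x y (c + e)) -> log_le x y c.
Proof.
move=> h; have [r0|r0] := eqVneq (rho x y) 0.
  by rewrite /log_le r0 expr0n/= expR_ge0.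
have p : 0 < rho x y ^+ 2 by rewrite exprn_gt0// lt0r r0 antipodal_ge0.
rewrite /log_le -(lnK p) ler_expR; apply/ler_addgt0Pr => e /h.
by rewrite /log_le -{1}(lnK p) ler_expR.
Qed.

Lemma log_le_convex x y c c' t : 0 <= t <= 1 ->
  log_le x y c -> log_le x y c' -> log_le x y ((1 - t) * c + t * c').
Proof.
move=> /andP[t0 t1]; have [cc' h _|cc' _] := lerP c c'.
  by apply: log_le_trans h; nra.
by apply: log_le_trans; nra.
Qed.

Definition bounded_by M f := forall x, `|f x| <= M.

(** The conjugate f^c(x) = sup_y (b(x, y) - f(y)), written as the least upper
    bound because b takes the value -oo. *)
Definition conjugate f x : R := inf [set c | forall y, log_le x y (c + f y)].

(** Every x has a y with b(x, y) = 0, and b <= 0 everywhere: these two facts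
    keep the conjugate of a bounded function within the same bound. *)
Lemma conjugate_lbound M f x c : bounded_by M f ->
  (forall y, log_le x y (c + f y)) -> - M <= c.
Proof.
move=> fM; have [y xy] := antipodal_partner x.
by move=> /(_ y)/(log_le_partner xy); have := fM y; rewrite ler_norml; lra.
Qed.

Lemma conjugate_ubound M f x y : bounded_by M f -> log_le x y (M + f y).
Proof.
by move=> fM; apply: log_le_ge0; have := fM y; rewrite ler_norml; lra.
Qed.

Lemma conjugate_leP M f x c : bounded_by M f ->
  (forall y, log_le x y (c + f y)) <-> conjugate f x <= c.
Proof.
move=> fM; set S := [set c | forall y, log_le x y (c + f y)].
have Sl : has_lbound S by exists (- M) => t; exact: conjugate_lbound.
have S0 : S !=set0 by exists M => y; exact: conjugate_ubound.
split=> [h|h y]; first exact: ge_inf.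
apply: log_le_closed => e e0.
have [t St tl] := inf_adherent e0 (conj S0 Sl).
by apply: log_le_trans (St y); rewrite /conjugate -/S in h; lra.
Qed.

Lemma conjugate_log_le M f x y : bounded_by M f ->
  log_le x y (conjugate f x + f y).
Proof. by move=> fM; move: y; apply/conjugate_leP; eauto. Qed.

Lemma conjugate_bounded M f : bounded_by M f -> bounded_by M (conjugate f).
Proof.
move=> fM x; rewrite ler_norml; apply/andP; split.
  by apply: (conjugate_lbound (x := x) fM) => y; exact: conjugate_log_le.
by apply/conjugate_leP; eauto => y; exact: conjugate_ubound.
Qed.

(** Conjugation reverses order and commutes with constants up to sign, hence is
    1-Lipschitz for the sup distance. *)
Lemma conjugate_anti M N f g d x : bounded_by M f -> bounded_by N g ->
  (forall y, g y <= f y + d) -> conjugate f x <= conjugate g x + d.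
Proof.
move=> fM gN gf; apply/conjugate_leP; eauto => y.
by apply: log_le_trans (conjugate_log_le x y gN); have := gf y; lra.
Qed.

Definition dominating f : Prop :=
  (exists M, bounded_by M f) /\ forall x y, log_le x y (f x + f y).

Definition tight f : Prop :=
  (exists M, bounded_by M f) /\ conjugate f =1 f.

Lemma tight_dominating f : tight f -> dominating f.
Proof.
move=> [[M fM] fE]; split; first by exists M.
by move=> x y; rewrite -{1}fE; exact: conjugate_log_le.
Qed.

Lemma conjugate_le f x : dominating f -> conjugate f x <= f x.
Proof. by move=> [[M fM] h]; apply/conjugate_leP; eauto. Qed.

Lemma dominating_convex f g t : 0 <= t <= 1 -> dominating f -> dominating g ->
  dominating (fun x => (1 - t) * f x + t * g x).
Proof.
move=> t01 [[M fM] fd] [[N gN] gd]; split.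
  have /andP[t0 t1] := t01; exists (M + N) => x.
  have := fM x; have := gN x; rewrite !ler_norml => /andP[? ?] /andP[? ?].
  have := normr_ge0 (f x); have := normr_ge0 (g x).
  have := fM x; have := gN x.
  by move=> *; apply/andP; split; nra.
move=> x y; have := log_le_convex t01 (fd x y) (gd x y).
by congr log_le; ring.
Qed.

(** * The retraction onto tight functions *)

Definition halve f x : R := (f x + conjugate f x) / 2.

Lemma halve_bounded M f : bounded_by M f -> bounded_by M (halve f).
Proof.
move=> fM x; have := fM x; have := conjugate_bounded fM x.
by rewrite /halve !ler_norml => /andP[? ?] /andP[? ?]; apply/andP; split; lra.
Qed.

(** Both f(x) + f^c(y) and f^c(x) + f(y) bound b(x, y), and so does their
    average, which is the sum of the values at x and y of (f + f^c) / 2. *)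
Lemma halve_dominating f : dominating f -> dominating (halve f).
Proof.
move=> [[M fM] fd]; split; first by exists M; exact: halve_bounded.
move=> x y; have h1 := conjugate_log_le x y fM.
have h2 := log_leC (conjugate_log_le y x fM).
have := @log_le_convex x y _ _ 2^-1 _ h1 h2; rewrite invr_ge0 ler0n/=.
by rewrite invf_le1// ler1n => /(_ isT); congr log_le; rewrite /halve; lra.
Qed.

Lemma halve_le f x : dominating f -> halve f x <= f x.
Proof. by move=> /(@conjugate_le _ x); rewrite /halve; lra. Qed.

(** Halving decreases f, hence increases its conjugate: the distance between
    the two shrinks to the distance from f^c to the midpoint. *)
Lemma halve_gap f d : dominating f -> (forall x, f x - conjugate f x <= d) ->
  forall x, halve f x - conjugate (halve f) x <= d / 2.
Proof.
move=> fd fg x; have [[M fM] _] := fd; have [[N hN] _] := halve_dominating fd.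
have : conjugate f x <= conjugate (halve f) x + 0.
  by apply: conjugate_anti fM hN _ => y; rewrite addr0; exact: halve_le.
by have := fg x; rewrite /halve; lra.
Qed.

Lemma halve_lip f g d : dominating f -> dominating g ->
  (forall x, `|f x - g x| <= d) -> forall x, `|halve f x - halve g x| <= d.
Proof.
move=> [[M fM] _] [[N gN] _] fg x.
have fg' y : f y <= g y + d /\ g y <= f y + d.
  by have := fg y; rewrite ler_norml; lra.
have := conjugate_anti x fM gN (fun y => (fg' y).2).
have := conjugate_anti x gN fM (fun y => (fg' y).1).
have := fg' x; rewrite /halve => -[? ?] ? ?.
by rewrite ler_norml; apply/andP; split; lra.
Qed.

Lemma iter_halve_dominating n f : dominating f -> dominating (iter n halve f).
Proof. by move=> fd; elim: n => //= n; exact: halve_dominating. Qed.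

Lemma iter_halve_bounded n M f : bounded_by M f ->
  bounded_by M (iter n halve f).
Proof. by move=> fd; elim: n => //= n; exact: halve_bounded. Qed.

Lemma iter_halve_gap n f d : dominating f ->
  (forall x, f x - conjugate f x <= d) ->
  forall x, iter n halve f x - conjugate (iter n halve f) x <= d / 2 ^+ n.
Proof.
move=> fd fg; elim: n => [|n IH] x /=; first by rewrite expr0 divr1.
rewrite exprSr invfM mulrA; apply: halve_gap => //.
exact: iter_halve_dominating.
Qed.

Lemma iter_halve_le m n f x : (m <= n)%N -> dominating f ->
  iter n halve f x <= iter m halve f x.
Proof.
move=> mn fd; rewrite -(subnK mn).
elim: (n - m)%N => //= k /(le_trans _); apply.
by apply: halve_le; exact: iter_halve_dominating.
Qed.

(** The successive decrements are at most d / 2 ^ (n + 1), d / 2 ^ (n + 2), and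
    so on: a geometric series with sum d / 2 ^ n. *)
Lemma iter_halve_drop n k f d x : dominating f ->
  (forall x, f x - conjugate f x <= d) ->
  iter n halve f x - d / 2 ^+ n <= iter (k + n) halve f x.
Proof.
move=> fd fg.
suff : iter n halve f x - d / 2 ^+ n <=
    iter (k + n) halve f x - d / 2 ^+ (k + n).
  move=> /le_trans; apply; rewrite gerBl divr_ge0 ?exprn_ge0//.
  by apply: le_trans (fg x); rewrite subr_ge0 conjugate_le.
elim: k => //= k /le_trans; apply.
rewrite addSn exprSr invfM mulrA /= {2}/halve.
by have := iter_halve_gap (k + n) fd fg x; lra.
Qed.

(** The limit of the iterated averages; as they decrease, it is an infimum,
    which passes to the Lipschitz estimate directly. *)
Definition hull f x : R := inf (range (fun n => iter n halve f x)).

Lemma iter_halve_has_inf f x : dominating f ->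
  has_inf (range (fun n => iter n halve f x)).
Proof.
move=> [[M fM] _]; split; first by exists (iter 0 halve f x), 0%N.
exists (- M) => _ [n _ <-].
by have := iter_halve_bounded n fM x; rewrite ler_norml; lra.
Qed.

Lemma hull_le_iter n f x : dominating f -> hull f x <= iter n halve f x.
Proof.
by move=> fd; apply: ge_inf; [have [] := iter_halve_has_inf x fd|exists n].
Qed.

Lemma hull_ge f x c : dominating f ->
  (forall n, c <= iter n halve f x) -> c <= hull f x.
Proof.
move=> fd h; apply: lb_le_inf; first by have [] := iter_halve_has_inf x fd.
by move=> _ [n _ <-].
Qed.

Lemma hull_le f x : dominating f -> hull f x <= f x.
Proof. by move=> fd; have := hull_le_iter 0 x fd. Qed.

Lemma hull_bounded M f : dominating f -> bounded_by M f ->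
  bounded_by M (hull f).
Proof.
move=> fd fM x; rewrite ler_norml; apply/andP; split.
  apply: hull_ge => // n.
  by have := iter_halve_bounded n fM x; rewrite ler_norml; lra.
by apply: (le_trans (hull_le x fd)); have := fM x; rewrite ler_norml; lra.
Qed.

Lemma hull_approx f e : dominating f -> 0 < e -> exists n, forall x,
  iter n halve f x - conjugate (iter n halve f) x <= e /\
  iter n halve f x - e <= hull f x.
Proof.
move=> fd e0; have [[M fM] _] := fd.
have [d d0 fg] : exists2 d, 0 <= d & forall x, f x - conjugate f x <= d.
  exists (`|M + M|) => // x; have := fM x; have := conjugate_bounded fM x.
  by have := ler_norm (M + M); rewrite !ler_norml; lra.
pose n := Num.Def.archi_bound (d / e); exists n => x.
have dn : d / 2 ^+ n <= e.
  rewrite ler_pdivrMr ?exprn_gt0// mulrC -ler_pdivrMr// ltW//.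
  exact: upper_nthrootP.
split; first exact: le_trans (iter_halve_gap n fd fg x) dn.
apply: hull_ge => // m; have [nm|mn] := leqP n m.
  by rewrite -(subnK nm); have := iter_halve_drop n (m - n) x fd fg; lra.
by have := iter_halve_le x (ltnW mn) fd; lra.
Qed.

(** Passing to the limit in domination gives (hull f)^c <= hull f. As hull f
    lies below each iterate g, its conjugate lies above g^c, which is as close
    to g as desired, whence the converse. *)
Lemma hull_tight f : dominating f -> tight (hull f).
Proof.
move=> fd; have [[M fM] _] := fd; have hM := hull_bounded fd fM.
split; first by exists M.
have hd : dominating (hull f).
  split; first by exists M.
  move=> x y; apply: log_le_closed => e e0.
  have e20 : 0 < e / 2 by rewrite divr_gt0.
  have [n hn] := hull_approx fd e20; have [_ nd] := iter_halve_dominating n fd.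
  by apply: log_le_trans (nd x y); have [_ ?] := hn x; have [_ ?] := hn y; lra.
move=> x; apply/eqP; rewrite eq_le conjugate_le//=; apply/ler_addgt0Pr => e e0.
have [n hn] := hull_approx fd e0; have [gap _] := hn x.
have : conjugate (iter n halve f) x <= conjugate (hull f) x + 0.
  apply: conjugate_anti (iter_halve_bounded n fM) hM _ => y.
  by rewrite addr0; exact: hull_le_iter.
by have := hull_le_iter n x fd; lra.
Qed.

Lemma hull_id f : tight f -> hull f =1 f.
Proof.
move=> ft x; have fd := tight_dominating ft; have [_ fE] := ft.
have hf : halve f = f by apply/funext => y; rewrite /halve fE; lra.
have itf n : iter n halve f = f by elim: n => //= n ->.
by apply/eqP; rewrite eq_le hull_le//=; apply: hull_ge => // n; rewrite itf.
Qed.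

Lemma hull_lip f g d : dominating f -> dominating g ->
  (forall x, `|f x - g x| <= d) -> forall x, `|hull f x - hull g x| <= d.
Proof.
move=> fd gd fg x.
have it n y : `|iter n halve f y - iter n halve g y| <= d.
  by elim: n y => //= n IH; apply: halve_lip IH; exact: iter_halve_dominating.
rewrite ler_norml; apply/andP; split.
  suff : hull g x - d <= hull f x by lra.
  apply: hull_ge => // n; have := hull_le_iter n x gd.
  by have := it n x; rewrite ler_norml; lra.
suff : hull f x - d <= hull g x by lra.
apply: hull_ge => // n; have := hull_le_iter n x fd.
by have := it n x; rewrite ler_norml; lra.
Qed.

(** Conjugation is 1-Lipschitz, so its fixed points are closed under uniform
    limits. *)
Lemma tight_closed f :
  (forall e, 0 < e -> exists2 g, tight g & forall x, `|g x - f x| <= e) ->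
  tight f.
Proof.
move=> h; have [g0 [[M gM] _] g0f] := h 1 ltr01.
have fM : bounded_by (M + 1) f.
  by move=> x; have := gM x; have := g0f x; rewrite !ler_norml; lra.
split; first by exists (M + 1).
move=> x; apply/eqP; rewrite eq_le.
apply/andP; split; apply/ler_addgt0Pr => e e0;
  have [g [[N gN] gE] gf] := h (e / 2) (divr_gt0 e0 (ltr0Sn _ _)).
- have : conjugate f x <= conjugate g x + e / 2.
    apply: conjugate_anti fM gN _ => y.
    by have := gf y; rewrite ler_norml; lra.
  by have := gf x; rewrite gE ler_norml; lra.
- have : conjugate g x <= conjugate f x + e / 2.
    apply: conjugate_anti gN fM _ => y.
    by have := gf y; rewrite ler_norml; lra.
  by have := gf x; rewrite gE ler_norml; lra.
Qed.

(** As e^f(x) is the supremum over y of rho(x, y)^2 e^-f(y), a change of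
    rho(x, .)^2 by at most e changes it by at most e times e^M; comparing with
    e^f(x) >= e^-M costs the other factor e^M. *)
Lemma tight_modulus f M x x' e : tight f -> bounded_by M f -> 0 <= e ->
  (forall y, `|rho x y ^+ 2 - rho x' y ^+ 2| <= e) ->
  f x' <= f x + e * expR (M + M).
Proof.
move=> ft fM e0 xx'; have [_ fE] := ft.
rewrite -fE; apply/conjugate_leP; eauto => y.
have [_ /(_ x y)] := tight_dominating ft; rewrite /log_le => xy.
have le1 : 1 <= expR (M + M) * expR (f x + f y).
  rewrite -expRD -expR0 ler_expR.
  by have := fM x; have := fM y; rewrite !ler_norml; lra.
have := expR_ge1Dx (e * expR (M + M)).
have -> : f x + e * expR (M + M) + f y = (f x + f y) + e * expR (M + M) by ring.
have := expR_gt0 (f x + f y); have := xx' y.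
rewrite ler_norml => /andP[h _] p q.
apply: (@le_trans _ _ (expR (f x + f y) * (1 + e * expR (M + M)))).
  rewrite mulrDr mulr1.
  have : e <= expR (f x + f y) * (e * expR (M + M)).
    by rewrite mulrCA (mulrC (expR (f x + f y))) ler_peMr.
  by lra.
by rewrite [leRHS]expRD ler_pM2l.
Qed.

(** * Tight functions on a compact space *)

Hypothesis Tcompact : compact [set: T].

Lemma near_uniform x e : 0 < e ->
  \forall x' \near x, forall y, `|rho x y ^+ 2 - rho x' y ^+ 2| <= e.
Proof.
move=> e0; have [rc _ _ _] := antipodal_sep.
have c2 (p : T * T) : {for p, continuous (fun p : T * T => rho p.1 p.2 ^+ 2)}.
  by apply: cvgM; exact: rc.
suff : \forall x' \near x,
    [set: T] `<=` [set y | `|rho x y ^+ 2 - rho x' y ^+ 2| <= e].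
  by apply: filterS => x' h y; exact: h.
have /compact_near_coveringP := Tcompact; apply => y _.
have e20 : 0 < e / 2 by rewrite divr_gt0.
have /cvgrPdist_le/(_ _ e20)[[U V] /= [xU yV] UV] := c2 (x, y).
exists (V, U) => // -[y' x'] /= [Vy' Ux'].
have := UV (x', y') (conj Ux' Vy').
have := UV (x, y') (conj (nbhs_singleton xU) Vy') => /=.
by rewrite !ler_norml; lra.
Qed.

Lemma tight_equicontinuous M x e : 0 < e ->
  \forall x' \near x, forall f, tight f -> bounded_by M f -> `|f x - f x'| <= e.
Proof.
move=> e0; have p : 0 < e / expR (M + M) by rewrite divr_gt0// expR_gt0.
have := near_uniform x p; apply: filterS => x' h f ft fM.
have h' y : `|rho x' y ^+ 2 - rho x y ^+ 2| <= e / expR (M + M).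
  by rewrite distrC.
have := tight_modulus ft fM (ltW p) h; have := tight_modulus ft fM (ltW p) h'.
by rewrite divfK ?gt_eqF ?expR_gt0// ler_norml; lra.
Qed.

Lemma tight_continuous f : tight f -> continuous f.
Proof.
move=> ft x; have [[M fM] _] := ft; apply/cvgrPdist_le => e e0.
by have := tight_equicontinuous M x e0; apply: filterS => x' /(_ f ft fM).
Qed.

(** The supremum defining f^c(x) is reached by compactness. This is what makes
    the twisted function below take the value 1 at every point. *)
Lemma tight_attained f x : tight f ->
  exists y, rho x y ^+ 2 = expR (f x + f y).
Proof.
move=> ft; have [[M fM] fE] := ft; have [rc _ _ _] := antipodal_sep.
pose v y := rho x y ^+ 2 * expR (- f y).
have vc : continuous v.
  move=> y; apply: cvgM.
    have rx : {for y, continuous (rho x)}.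
      apply: (@continuous_comp _ _ _ (fun y => (x, y)) (fun p => rho p.1 p.2)).
        by apply: cvg_pair; [exact: cvg_cst|exact: cvg_id].
      exact: rc.
    by apply: cvgM; exact: rx.
  apply: (@continuous_comp _ _ _ (fun y => - f y) (@expR R)).
    by apply: cvgN; exact: tight_continuous.
  exact: continuous_expR.
have [|y _ vmax] := compact_EVT_max _ Tcompact (continuous_subspaceT vc).
  by exists x.
have {}vmax t : v t <= v y by apply: vmax; rewrite inE.
(* A point z with rho x z = 1 makes the maximum positive, so that it has a
   logarithm. *)
have [z xz] := antipodal_partner x.
have v0 : 0 < v y.
  by apply: lt_le_trans (vmax z); rewrite /v xz expr1n mul1r expR_gt0.
exists y; apply/eqP; rewrite eq_le.
have [_ fd] := tight_dominating ft; have /= -> := fd x y.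
have : f x <= ln (v y).
  rewrite -fE; apply/conjugate_leP; eauto => t.
  rewrite /log_le expRD lnK ?posrE// -ler_pdivrMr ?expR_gt0// -expRN.
  exact: vmax.
rewrite -ler_expR lnK ?posrE// /v expRN ler_pdivlMr ?expR_gt0//.
by rewrite -expRD.
Qed.

(** * Tight functions as potentials *)

(** The function conformal to rho with potential f. *)
Definition twist f x y : R := rho x y * expR (- (f x + f y) / 2).

Lemma twist_sq f x y : twist f x y ^+ 2 = rho x y ^+ 2 * expR (- (f x + f y)).
Proof.
by rewrite exprMn; congr (_ * _); rewrite expr2 -expRD; congr expR; lra.
Qed.

Lemma twist_separating f : continuous f -> separating (twist f).
Proof.
have [rc r0 rs re] := antipodal_sep; move=> fc; split.
- move=> p; apply: cvgM; first exact: rc.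
  apply: (@continuous_comp _ _ _
    (fun p : T * T => - (f p.1 + f p.2) / 2) (@expR R)); last first.
    exact: continuous_expR.
  apply: cvgMl; apply: cvgN; apply: cvgD.
    by apply: (@continuous_comp _ _ _ fst f); [exact: cvg_fst|exact: fc].
  by apply: (@continuous_comp _ _ _ snd f); [exact: cvg_snd|exact: fc].
- by move=> x y; rewrite mulr_ge0// expR_ge0.
- by move=> x y; rewrite /twist rs (addrC (f x)).
- move=> x y; rewrite -re /twist; split=> [/eqP|->]; last by rewrite mul0r.
  by rewrite mulf_eq0 (gt_eqF (expR_gt0 _)) orbF => /eqP.
Qed.

Lemma twist_antipodal f : tight f -> antipodal (twist f).
Proof.
move=> ft; have fs := twist_separating (tight_continuous ft).
have [_ t0 _ _] := fs.
have t1 x y : twist f x y <= 1.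
  rewrite -(@ler_pXn2r _ 2)// ?nnegrE// expr1n twist_sq.
  have [_ fd] := tight_dominating ft.
  by rewrite expRN ler_pdivrMr ?expR_gt0// mul1r; exact: fd.
have tE x : exists y, twist f x y = 1.
  have [y xy] := tight_attained x ft; exists y; apply/eqP.
  by rewrite -(@eqrXn2 _ 2)// expr1n twist_sq xy -expRD addrN expR0.
have [[_ [[x _] _ _]] _] := antipodal_has_sup.
have ub : ubound (range (fun p => twist f p.1 p.2)) 1 by move=> _ [p _ <-].
split => //; apply/eqP; rewrite eq_le; apply/andP; split.
  by apply: ge_sup => //; exists (twist f x x), (x, x).
have [y xy] := tE x; apply: sup_upper_bound; last by exists (x, y).
by split; [exists (twist f x x), (x, x)|exists 1].
Qed.

Lemma twist_is_mderiv f : continuous f ->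
  is_mderiv rho (twist f) (fun x => expR (- f x)).
Proof.
move=> fc; split=> [x|x|x y]; first exact: expR_gt0.
  apply: (@continuous_comp _ _ _ (fun y => - f y) (@expR R)).
    by apply: cvgN; exact: fc.
  exact: continuous_expR.
by rewrite twist_sq opprD expRD mulrC.
Qed.

End tight_span.

(** The cross-ratio does not see the weights of a conformal factor. *)
Lemma is_mderiv_moebius (R : realType) (T : topologicalType)
    (rho1 rho2 : T -> T -> R) f :
  separating rho1 -> separating rho2 -> is_mderiv rho1 rho2 f ->
  moebius_equiv rho2 rho1.
Proof.
move=> s1 s2 [f0 _ fE] x x' y y' /=; rewrite !inE !negb_or.
move=> /and4P[/and3P[xx' xy xy'] /andP[x'y x'y'] yy' _].
have p1 := sep_gt0 s1; have p2 := sep_gt0 s2.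
apply/eqP; rewrite -(@eqrXn2 _ 2)//; last 2 first.
- by rewrite divr_ge0// mulr_ge0// ltW ?p2.
- by rewrite divr_ge0// mulr_ge0// ltW ?p1.
rewrite !expr_div_n !exprMn !fE; apply/eqP; field.
by rewrite !gt_eqF// ?p1.
Qed.

(** Converse of [twist_antipodal]: domination says that rho2 <= 1, and a point y
    with rho2(x, y) = 1 is one where the supremum defining the conjugate at x is
    reached. *)
Lemma is_mderiv_tight (R : realType) (T : topologicalType)
    (rho1 rho2 : T -> T -> R) f :
  antipodal rho1 -> antipodal rho2 -> is_mderiv rho1 rho2 f ->
  (exists M, bounded_by M (fun x => - ln (f x))) ->
  tight rho1 (fun x => - ln (f x)).
Proof.
move=> a1 a2 [f0 _ fE] [M fM]; split; first by exists M.
have E x y : rho2 x y ^+ 2 = expR (- (- ln (f x) + - ln (f y))) * rho1 x y ^+ 2.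
  by rewrite -opprD opprK expRD !lnK ?posrE.
have le x y : log_le rho1 x y (- ln (f x) + - ln (f y)).
  have : rho2 x y ^+ 2 <= 1 by rewrite exprn_ile1 ?antipodal_ge0 ?antipodal_le1.
  by rewrite E expRN ler_pdivrMl ?expR_gt0// mulr1.
move=> x; apply/eqP; rewrite eq_le; apply/andP; split.
  by apply/(conjugate_leP a1); eauto.
have [y xy] := antipodal_partner a2 x.
have := conjugate_log_le a1 x y fM; rewrite /log_le.
rewrite -(ler_pM2l (expR_gt0 (- (- ln (f x) + - ln (f y))))).
rewrite -E xy expr1n -expRD -expR0 ler_expR; lra.
Qed.

(** * Paths of speed at most one *)

Section lipschitz_paths.
Variables (R : realType) (X : metricType R).
Implicit Types (u v : R -> X) (D : set R).

Definition nonexpansive_on D u :=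
  forall s t, D s -> D t -> s <= t -> mdist (u s) (u t) <= t - s.

Lemma nonexpansive_glue c D u : D c ->
  nonexpansive_on (D `&` [set t | t <= c]) u ->
  nonexpansive_on (D `&` [set t | c <= t]) u -> nonexpansive_on D u.
Proof.
move=> Dc ul ur s t Ds Dt st.
have [tc|ct] := leP t c.
  by apply: ul => //; split=> //; exact: le_trans tc.
have [cs|sc] := leP c s; first by apply: ur => //; split=> //=; exact: ltW.
have := ul s c (conj Ds (ltW sc)) (conj Dc (lexx _)) (ltW sc).
have := ur c t (conj Dc (lexx _)) (conj Dt (ltW ct)) (ltW ct).
by have := metric_triangle (u s) (u c) (u t); lra.
Qed.

(** A path that is never faster than one and covers distance b - a between the
    times a and b cannot lose anything in between. *)
Lemma nonexpansive_isometric a b u :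
  nonexpansive_on [set t | a <= t <= b] u -> b - a <= mdist (u a) (u b) ->
  forall s t, a <= s <= b -> a <= t <= b -> mdist (u s) (u t) = `|s - t|.
Proof.
move=> ul uab; suff le s t : a <= s -> s <= t -> t <= b ->
    mdist (u s) (u t) = t - s.
  move=> s t /andP[as_ sb] /andP[at_ tb]; have [st|ts] := leP s t.
    by rewrite le// distrC ger0_norm// subr_ge0.
  by rewrite metric_sym le ?(ltW ts)// ger0_norm// subr_ge0 ltW.
move=> as_ st tb; apply/eqP; rewrite eq_le; apply/andP; split.
  by apply: ul => //=; apply/andP; split; lra.
have h1 : mdist (u a) (u s) <= s - a.
  by apply: ul => //=; apply/andP; split; lra.
have h2 : mdist (u t) (u b) <= b - t.
  by apply: ul => //=; apply/andP; split; lra.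
have := metric_triangle (u a) (u s) (u b).
by have := metric_triangle (u s) (u t) (u b); lra.
Qed.

End lipschitz_paths.

(** A cluster point of an ultrafilter on the line is a limit. *)
Lemma ultra_bounded_cvg (R : realType) (X : Type) (F : set_system X)
    (v : X -> R) (a b : R) : UltraFilter F ->
  (\forall x \near F, a <= v x <= b) -> exists l : R, v @ F --> l.
Proof.
move=> FU vab.
have [l [_ lc]] := @segment_compact R a b _ (fmap_proper_filter v _) vab.
exists l => V Vl; have [//|nV] := in_ultra_setVsetC (v @^-1` V) FU.
by have [t [/= nVt Vt]] := lc (~` V) V nV Vl.
Qed.

(** * Potentials of Moebius equivalent antipodal functions *)

Section potentials.
Variables (R : realType) (Z : antipodalSpace R).
Local Notation rho0 := (@antipodal_fun R Z).
Local Notation M := (moebiusSpace Z).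
Implicit Types (r s : M) (f g : Z -> R) (x y : Z).

Let rho0A : antipodal rho0 := @antipodal_funP R Z.
Let Zc : compact [set: Z] := @antipodal_compact R Z.

Definition moebius_base : M :=
  MoebiusSpace rho0A (fun _ _ _ _ _ => erefl).

Definition potential r : Z -> R := fun x => - ln (mderiv rho0 r x).

(** The chain rule for derivatives. *)
Lemma mderiv_potential r s x :
  ln (mderiv r s x) = potential r x - potential s x.
Proof.
have [p12 c12 E12] := moebius_derivP moebius_base r.
have [p23 c23 E23] := moebius_derivP r s.
rewrite /potential -[in X in - _ - - ln (X x)]/(mderiv moebius_base s).
have -> : mderiv moebius_base s = fun x => mderiv rho0 r x * mderiv r s x.
  apply: moebius_deriv_eq; split=> [z|z|z t]; first exact: mulr_gt0.
    by apply: cvgM; [exact: c12|exact: c23].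
  by rewrite E23 E12; ring.
by rewrite opprK lnM ?posrE// addKr.
Qed.

Lemma mdist_leP r s d :
  (forall x, `|potential r x - potential s x| <= d) <-> mdist r s <= d.
Proof.
split=> [h|h x]; first by apply: moebius_dist_le => x; rewrite mderiv_potential.
by rewrite -mderiv_potential; apply: le_trans h; exact: moebius_dist_ub.
Qed.

Lemma potential_dist r s x : `|potential r x - potential s x| <= mdist r s.
Proof. by move: x; apply/mdist_leP. Qed.

Lemma potential_le r s x : potential r x - potential s x <= mdist r s.
Proof. exact: le_trans (ler_norm _) (potential_dist r s x). Qed.

Lemma potential_tight r : tight rho0 (potential r).
Proof.
have rA := moebius_antipodal r.
have rP := moebius_derivP moebius_base r.
apply: (is_mderiv_tight rho0A rA rP); exists (moebius_dist moebius_base r) => x.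
by rewrite normrN; exact: moebius_dist_ub.
Qed.

Lemma potential_dominating r : dominating rho0 (potential r).
Proof. exact/tight_dominating/potential_tight. Qed.

Lemma potential_surj f : tight rho0 f -> exists r, potential r = f.
Proof.
move=> ft; have fc := tight_continuous rho0A Zc ft.
have tA := twist_antipodal rho0A Zc ft.
have tP := twist_is_mderiv rho0 fc.
have e := is_mderiv_moebius (antipodal_sep rho0A) (antipodal_sep tA) tP.
exists (MoebiusSpace tA e); apply/funext => x.
rewrite /potential.
rewrite (@moebius_deriv_eq _ _ moebius_base (MoebiusSpace tA e) _ tP).
by rewrite expRK opprK.
Qed.

Lemma potential_inj : injective potential.
Proof.
move=> r s rs; apply: mdist_positivity; apply/eqP.
rewrite eq_le mdist_ge0 andbT; apply/mdist_leP => x.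
by rewrite rs subrr normr0.
Qed.

(** The maximum of the absolute difference of the potentials is reached at some
    x by compactness. If the difference has the wrong sign there, it has the
    other sign, with at least the same size, at any y where the second potential
    g satisfies g(x) + g(y) = b(x, y): the first potential f obeys
    f(x) + f(y) >= b(x, y). *)
Lemma mdist_attained r s :
  exists x, potential r x - potential s x = mdist r s.
Proof.
pose v x := potential r x - potential s x.
have cont t : continuous (potential t).
  exact (tight_continuous rho0A Zc (potential_tight t)).
have vc : continuous (fun x => `|v x|).
  by move=> x; apply: cvg_norm; apply: cvgB; exact: cont.
have [x0 [_ _]] := antipodal_four_points Z.
have [|x _ vmax] := compact_EVT_max _ Zc (continuous_subspaceT vc).
  by exists x0.
have vx : `|v x| = mdist r s.
  apply/eqP; rewrite eq_le; apply/andP; split; first exact: potential_dist.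
  by apply/mdist_leP => t; apply: vmax; rewrite inE.
have [v0|v0] := leP 0 (v x); first by exists x; rewrite -vx ger0_norm.
(* If the difference is negative at x, the partner y of x for s replaces x. *)
have [y xy] := tight_attained rho0A Zc x (potential_tight s).
exists y; apply/eqP; rewrite eq_le potential_le/=.
have [_ /(_ x y)] := potential_dominating r.
rewrite /log_le xy ler_expR -vx ltr0_norm// /v; lra.
Qed.

(** The point of the Moebius space with potential [hull f]; the value
    [moebius_base] is a default for functions that are not dominating. *)
Definition retract f : M :=
  xget moebius_base [set r | potential r = hull rho0 f].

Lemma potential_retract f : dominating rho0 f ->
  potential (retract f) = hull rho0 f.
Proof.
move=> fd; have [r rP] := potential_surj (hull_tight rho0A fd).
exact: (@xgetI _ moebius_base [set r | potential r = hull rho0 f] r rP).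
Qed.

Lemma retract_potential r : retract (potential r) = r.
Proof.
apply: potential_inj; rewrite potential_retract; last first.
  exact: potential_dominating.
by apply/funext => x; rewrite hull_id//; exact: potential_tight.
Qed.

Lemma retract_lip f g d : dominating rho0 f -> dominating rho0 g ->
  (forall x, `|f x - g x| <= d) -> mdist (retract f) (retract g) <= d.
Proof.
move=> fd gd fg; apply/mdist_leP => x; rewrite !potential_retract//.
exact: hull_lip.
Qed.

(** * Segments and contraction *)

Definition segment r s t : M :=
  retract (fun x => (1 - t) * potential r x + t * potential s x).

Lemma segment0 r s : segment r s 0 = r.
Proof.
rewrite -[RHS]retract_potential; congr retract; apply/funext => x.
by rewrite subr0 mul1r mul0r addr0.
Qed.

Lemma segment1 r s : segment r s 1 = s.
Proof.
rewrite -[RHS]retract_potential; congr retract; apply/funext => x.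
by rewrite subrr mul0r mul1r add0r.
Qed.

Lemma segment_lip r r' s t t' : 0 <= t <= 1 -> 0 <= t' <= 1 ->
  mdist (segment r s t) (segment r' s t') <= mdist r r' + `|t - t'| * mdist r s.
Proof.
move=> t01 t01'; apply: retract_lip; try exact: dominating_convex
  (potential_dominating _) (potential_dominating _).
move=> x.
have -> : (1 - t) * potential r x + t * potential s x -
    ((1 - t') * potential r' x + t' * potential s x) =
    (1 - t') * (potential r x - potential r' x) -
    (t - t') * (potential r x - potential s x) by ring.
apply: le_trans (ler_normB _ _) _; rewrite !normrM; apply: lerD.
  apply: le_trans (potential_dist r r' x); rewrite ler_piMl// ger0_norm; lra.
by rewrite ler_wpM2l// potential_dist.
Qed.

Lemma moebius_geodesic : @geodesic_space R M.
Proof.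
move=> r s; exists 0, (mdist r s), (fun t => segment r s (t / mdist r s)).
have D0 := mdist_ge0 r s.
have E1 : segment r s (mdist r s / mdist r s) = s.
  have [D|D] := eqVneq (mdist r s) 0; last by rewrite divff// segment1.
  by rewrite D mul0r segment0; exact: mdist_positivity.
split; [split=> //| |exact: E1]; last by rewrite mul0r segment0.
move=> t t'; rewrite !in_itv/=.
apply: (@nonexpansive_isometric _ M _ _ (fun t => segment r s (t / mdist r s)));
  last first.
  by rewrite E1 mul0r segment0 subr0.
move=> {}t {}t' /= /andP[t0 tD] /andP[t0' tD'] tt'.
(* For equal endpoints t / mdist r s is t / 0 = 0 and the path is constant. *)
have [D|D] := eqVneq (mdist r s) 0.
  by rewrite D !invr0 !mulr0 mdistxx subr_ge0.
have Dp : 0 < mdist r s by rewrite lt0r D.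
have := @segment_lip r r s (t / mdist r s) (t' / mdist r s).
rewrite !divr_ge0// !ler_pdivrMr// !mul1r => /(_ tD tD')/le_trans; apply.
rewrite mdistxx add0r -mulrBl normrM normfV (ger0_norm D0).
by rewrite divfK// distrC ger0_norm// subr_ge0.
Qed.

(** Composing with the projection of the line onto the unit interval makes the
    contraction continuous for all times, hence on the required subspace. *)
Definition clamp t : R := Num.max 0 (Num.min t 1).

Lemma clamp_itv t : 0 <= clamp t <= 1.
Proof. by rewrite /clamp le_max lexx/= ge_max ler01 ge_min lexx orbT. Qed.

Lemma clamp_lip t u : `|clamp t - clamp u| <= `|t - u|.
Proof.
have := ler_norm (t - u); have := ler_norm (u - t); rewrite (distrC u).
rewrite /clamp !minEle; case: (leP t 1) => ?; case: (leP u 1) => ? ? ?;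
  rewrite !maxEle; do 2 ?case: ifPn; rewrite -?ltNge => *;
  rewrite ler_norml; apply/andP; split; lra.
Qed.

Lemma moebius_contractible : @contractible R M.
Proof.
exists moebius_base, (fun p => segment p.1 moebius_base (clamp p.2)).
split; last 2 first.
- by move=> r /=; rewrite /clamp minEle ler01 maxxx segment0.
- by move=> r /=; rewrite /clamp minxx maxEle ler01 segment1.
apply: continuous_subspaceT => -[r t] /=.
apply/cvg_ballP => e e0.
pose C := mdist r moebius_base + 1.
have C0 : 0 < C by rewrite ltr_wpDl// mdist_ge0.
have e20 : 0 < e / 2 by rewrite divr_gt0.
have eC : 0 < e / 2 / C by rewrite divr_gt0.
exists (ball r (e / 2), ball t (e / 2 / C)).
  by split; exact: nbhsx_ballx.
move=> -[s u] [/=]; rewrite ballEmdist /= => rs; rewrite /ball/= => tu.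
apply: le_lt_trans (segment_lip r s moebius_base (clamp_itv t) (clamp_itv u)) _.
rewrite [ltRHS](splitr e) ltrD//.
apply: (@le_lt_trans _ _ (`|t - u| * C)).
  by rewrite ler_pM ?mdist_ge0 ?clamp_lip// lerDl.
by rewrite -ltr_pdivlMr.
Qed.

(** * Properness *)

(** An ultrafilter on a ball converges pointwise, since potentials are bounded
    there. Equicontinuity and compactness of Z make the convergence uniform; the
    limit is then tight, hence the potential of a limit point. *)
Lemma moebius_proper : @proper_space R M.
Proof.
move=> c d; rewrite compact_ultra => F FU FB.
have pb : \forall r \near F, forall x, `|potential c x - potential r x| <= d.
  by apply: filterS FB => r /mdist_leP.
have [K fK] : exists K, \forall r \near F, bounded_by K (potential r).
  have [[K cK] _] := potential_tight c; exists (K + d).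
  apply: filterS pb => r h x.
  by have := h x; have := cK x; rewrite !ler_norml; lra.
have /choice[l lP] x : exists l : R, (fun r : M => potential r x) @ F --> l.
  apply: (@ultra_bounded_cvg _ _ _ _ (- K) K).
  by apply: filterS fK => r /(_ x); rewrite ler_norml.
have near_l x e : 0 < e -> \forall r \near F, `|l x - potential r x| <= e.
  by move=> e0; have /cvgrPdist_le/(_ e e0) := lP x.
have unif e : 0 < e -> \forall r \near F, forall x, `|potential r x - l x| <= e.
  move=> e0; have e50 : 0 < e / 5 by rewrite divr_gt0.
  suff : \forall r \near F, [set: Z] `<=` [set x | `|potential r x - l x| <= e].
    by apply: filterS => r h x; exact: h.
  have /compact_near_coveringP := Zc; apply => x _.
  have eqc := tight_equicontinuous rho0A Zc K x e50.
  (* The error at x' is at most the sum of five terms, travelling from r to an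
     auxiliary s of the filter, which approximates l both at x and at x'. *)
  exists ([set x' | forall f, tight rho0 f -> bounded_by K f ->
      `|f x - f x'| <= e / 5],
    [set r | `|l x - potential r x| <= e / 5 /\ bounded_by K (potential r)]).
    by split => //=; apply: filterI => //; exact: near_l.
  move=> [x' r] /= [hx' [hr rK]].
  have [s [[sx sx'] sK]] := filter_ex (filterI (filterI (near_l x _ e50)
    (near_l x' _ e50)) fK).
  have := hx' _ (potential_tight s) sK.
  have := hx' _ (potential_tight r) rK.
  by move: hr sx sx'; rewrite !ler_norml; lra.
have lt : tight rho0 l.
  apply: (tight_closed rho0A) => e /unif/filter_ex[r re].
  by exists (potential r) => //; exact: potential_tight.
have [q ql] := potential_surj lt.
exists q; split=> /=.
  apply/mdist_leP => x; apply/ler_addgt0Pr => e e0.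
  have [r [h1 h2]] := filter_ex (filterI pb (near_l x e e0)).
  by have := h1 x; move: h2; rewrite ql !ler_norml; lra.
apply/cvg_ballP => e e0; have e20 : 0 < e / 2 by rewrite divr_gt0.
apply: filterS (unif _ e20) => r h; rewrite ballEmdist /=.
apply: (@le_lt_trans _ _ (e / 2)); last by lra.
by apply/mdist_leP => x; rewrite ql distrC.
Qed.

(** * Rays and geodesic lines *)

Definition tilt f y t : Z -> R := fun x => if x == y then f x - t else f x + t.

(** The only pair at which the sum decreases is (y, y), where b = -oo. *)
Lemma tilt_dominating f y t : 0 <= t -> dominating rho0 f ->
  dominating rho0 (tilt f y t).
Proof.
move=> t0 [[K fK] fd]; split.
  exists (K + t) => x; have := fK x; rewrite /tilt.
  by case: ifP => _; rewrite !ler_norml; lra.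
move=> x x'; rewrite /tilt.
case: eqP => [->|_]; case: eqP => [->|_].
- exact: log_le_diag.
- by apply: log_le_trans (fd y x'); lra.
- by apply: log_le_trans (fd x y); lra.
- by apply: log_le_trans (fd x x'); lra.
Qed.

(** On the boundary Z, this ray runs towards y. *)
Definition ray r y t : M := retract (tilt (potential r) y t).

Lemma ray0 r y : ray r y 0 = r.
Proof.
rewrite -[RHS]retract_potential; congr retract; apply/funext => x.
by rewrite /tilt subr0 addr0 if_same.
Qed.

Lemma ray_lip r y (s t : R) : 0 <= s -> 0 <= t ->
  mdist (ray r y s) (ray r y t) <= `|s - t|.
Proof.
move=> s0 t0; have rd := potential_dominating r.
apply: retract_lip; try exact: tilt_dominating.
move=> x; rewrite /tilt; case: eqP => _.
  by rewrite [X in `|X|](_ : _ = t - s) 1?distrC//; ring.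
by rewrite [X in `|X|](_ : _ = s - t)//; ring.
Qed.

Lemma ray_le r y t : 0 <= t -> potential (ray r y t) y <= potential r y - t.
Proof.
move=> t0; have rd := tilt_dominating y t0 (potential_dominating r).
rewrite potential_retract//; apply: le_trans (hull_le rho0A y rd) _.
by rewrite /tilt eqxx.
Qed.

Lemma moebius_geodesically_complete : @geodesically_complete R M.
Proof.
move=> a b g [ab gi].
have [y yD] := mdist_attained (g a) (g b).
have [y' yy'] := tight_attained rho0A Zc y (potential_tight (g a)).
have gab : mdist (g a) (g b) = b - a.
  by rewrite gi ?in_itv/= ?lexx ?ab// distrC ger0_norm// subr_ge0.
pose l t := if t <= a then ray (g a) y' (a - t)
  else if t <= b then g t else ray (g b) y (t - b).
have lg t : a <= t -> t <= b -> l t = g t.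
  rewrite /l => at_ ->; case: ifP => // ta.
  by have -> : t = a; [lra|rewrite subrr ray0].
have lL t : t <= a -> l t = ray (g a) y' (a - t) by rewrite /l => ->.
have lR t : b <= t -> l t = ray (g b) y (t - b).
  move=> bt; have [tb|tb] := leP t b.
    have -> : t = b by lra.
    by rewrite subrr ray0 lg.
  by rewrite /l !leNgt tb (le_lt_trans ab tb).
have l1 : nonexpansive_on [set: R] l.
  apply: (@nonexpansive_glue _ _ a) => //.
    move=> s t [_ /= sa] [_ /= ta] st; rewrite !lL//.
    apply: le_trans (ray_lip _ _ _ _) _; rewrite ?subr_ge0//.
    by rewrite ler_norml; lra.
  apply: (@nonexpansive_glue _ _ b) => //.
    move=> s t [[_ /= as_] /= sb] [[_ /= at_] /= tb] st; rewrite !lg//.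
    rewrite gi ?in_itv/= ?as_ ?at_//.
    by rewrite ler_norml; lra.
  move=> s t [_ /= bs] [_ /= bt] st; rewrite !lR//.
  apply: le_trans (ray_lip _ _ _ _) _; rewrite ?subr_ge0//.
  by rewrite ler_norml; lra.
exists l; last by move=> t; rewrite in_itv/= => /andP[]; exact: lg.
have far N : - N <= a -> b <= N -> N + N <= mdist (l (- N)) (l N).
  move=> Na bN; apply: le_trans (potential_le _ _ y); rewrite lL// lR//.
  (* At time - N the value at y' is below that of g a by at least a + N. Since
     y, y' is a pair of equality for g a, the value at y is above it by at
     least a + N. *)
  have N0 : 0 <= a - - N by lra.
  have N1 : 0 <= N - b by lra.
  have := ray_le (g b) y N1; have := ray_le (g a) y' N0.
  have [_ /(_ y y')] := potential_dominating (ray (g a) y' (a - - N)).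
  by rewrite /log_le yy' ler_expR; lra.
move=> s t; pose N := `|a| + `|b| + `|s| + `|t|.
have [Na Nb Ns Nt] : [/\ `|a| <= N, `|b| <= N, `|s| <= N & `|t| <= N].
  have := normr_ge0 a; have := normr_ge0 b; have := normr_ge0 s.
  by have := normr_ge0 t; rewrite /N; split; lra.
move: Na Nb Ns Nt; rewrite !ler_norml => /andP[Na _] /andP[_ Nb] Ns Nt.
apply: (@nonexpansive_isometric _ _ (- N) N) Ns Nt.
  by move=> s' t' _ _; exact: l1.
by rewrite opprK; exact: far.
Qed.

Lemma moebius_unbounded : @unbounded_space R M.
Proof.
move=> K.
have [|l lP _] := @moebius_geodesically_complete 0 0 (cst moebius_base).
  split=> // s t; rewrite !in_itv/= => s0 t0.
  by rewrite mdistxx (_ : s - t = 0) ?normr0//; lra.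
exists (l (`|K| + 1)), (l 0); rewrite lP subr0 ger0_norm ?addr_ge0//.
by rewrite (le_lt_trans (ler_norm K))// ltrDl.
Qed.

End potentials.

Theorem theorem1p1 (R : realType) (Z : antipodalSpace R) :
  [/\ @unbounded_space R (moebiusSpace Z),
      @contractible R (moebiusSpace Z),
      @proper_space R (moebiusSpace Z),
      @geodesic_space R (moebiusSpace Z) &
      @geodesically_complete R (moebiusSpace Z)].
Proof.
split; [exact: moebius_unbounded|exact: moebius_contractible
  |exact: moebius_proper|exact: moebius_geodesic
  |exact: moebius_geodesically_complete].
Qed.
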